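(* Let $M=(V,D)$ be a proper set system and let $Y\subseteq V$. Then \[ Q(M+Y)=\sum_{(A,B,C)\in\mathcal{P}_3(V)} a_A\, b_{B\oplus Y'}\, c_{C\oplus Y'}\, y^{d_{M*B\,\bar{*}\,C}}\quad\text{with } Y'=Y\setminus A,\] \[ Q(M\,\bar{*}\,Y)=\sum_{(A,B,C)\in\mathcal{P}_3(V)} a_{A\oplus Y'}\, b_{B}\, c_{C\oplus Y'}\, y^{d_{M*B\,\bar{*}\,C}}\quad\text{with } Y'=Y\setminus B,\] \[ Q(M*Y)=\sum_{(A,B,C)\in\mathcal{P}_3(V)} a_{A\oplus Y'}\, b_{B\oplus Y'}\, c_{C}\, y^{d_{M*B\,\bar{*}\,C}}\quad\text{with } Y'=Y\setminus C.\]
   Context: A set system is a pair $M=(V,D)$ with $V$ a finite set and $D$ a family of subsets of $V$; we write $Z\in M$ for $Z\in D$. $M$ is proper if $D\neq\emptyset$. $\oplus$ denotes symmetric difference (of sets, and of families of sets). For $X\subseteq V$, the pivot is $M*X=(V,\{Z\oplus X: Z\in D\})$. For $u\in V$, loop complementation is $M+u=(V,\,D\oplus\{Z\cup\{u\}: Z\in D,\ u\notin Z\})$. Operations are applied left to right (e.g. $M+u*u$ means $(M+u)*u$). The dual pivot is $M\,\bar{*}\,u = M+u*u+u$. Operations on distinct elements commute, so for $X\subseteq V$, $M+X$ and $M\,\bar{*}\,X$ denote applying $+u$ (resp. $\bar{*}\,u$) for each $u\in X$. For proper $M$ and $X\subseteq V$, $d_M(X)=\min\{|X\oplus Z|: Z\in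 M\}$ and $d_M=d_M(\emptyset)$. $\mathcal{P}_3(V)$ is the set of ordered triples $(A,B,C)$ of pairwise disjoint subsets of $V$ (possibly empty) with $A\cup B\cup C=V$. The multivariate interlace polynomial is $Q(M)=\sum_{(A,B,C)\in\mathcal{P}_3(V)} a_A b_B c_C\, y^{d_{M*B\,\bar{*}\,C}}$, where $y$ and the $a_S,b_S,c_S$ ($S\subseteq V$) are indeterminates. *)

(* Defs.v *)
From mathcomp Require Import all_boot all_order all_algebra.
From mathcomp Require Export mpoly.

Set Implicit Arguments.
Unset Strict Implicit.
Unset Printing Implicit Defensive.

Import GRing.Theory.
Local Open Scope ring_scope.

Definition symdiff (T : finType) (A B : {set T}) : {set T} :=
  (A :\: B) :|: (B :\: A).

Notation "A :+: B" := (symdiff A B) (at level 52, left associativity).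

(* A set system (V, D) is represented by the family D; V is all of the type. *)
Definition set_system (V : finType) := {set {set V}}.

Section SetSystems.
Variable V : finType.
Implicit Types (M : set_system V) (X : {set V}) (u : V).

Definition proper_system M : bool := M != set0.

(* M * X *)
Definition pivot M X : set_system V := [set Z :+: X | Z in M].

(* M + u *)
Definition loopc1 M u : set_system V :=
  M :+: [set u |: Z | Z in M & u \notin Z].

(* M \bar{*} u = M + u * u + u, read from left to right *)
Definition dpivot1 M u : set_system V :=
  loopc1 (pivot (loopc1 M u) [set u]) u.

(* M + X and M \bar{*} X: one step for each element of X. Steps at distinct  *)
(* elements commute, so following the order of enum X is immaterial.         *)
Definition loopc M X : set_system V := foldl loopc1 M (enum X).
Definition dpivot M X : set_system V := foldl dpivot1 M (enum X).

(* The default #|V| of the iterated minimum is an upper bound of all the     *)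
(* values, so for a proper M this is their minimum; see distP.               *)
Definition dist M X : nat := \big[minn/#|V|]_(Z in M) #|X :+: Z|.

Lemma distP M X : proper_system M ->
  (exists2 Z, Z \in M & dist M X = #|X :+: Z|) /\
  (forall Z, Z \in M -> (dist M X <= #|X :+: Z|)%N).
Proof.
move=> /set0Pn[Z0 MZ0].
have lb Z : Z \in M -> (dist M X <= #|X :+: Z|)%N.
  move=> MZ; rewrite /dist; have := mem_index_enum Z.
  elim: (index_enum _) => //= Z' s IH; rewrite inE big_cons.
  case/predU1P=> [<- | /IH leZ]; first by rewrite MZ geq_minl.
  by case: ifP => // _; rewrite geq_min leZ orbT.
split=> //.
have : (exists2 Z, Z \in M & dist M X = #|X :+: Z|) \/ dist M X = #|V|.
  rewrite /dist; elim/big_rec: _ => [|Z d MZ IH]; first by right.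
  by rewrite /minn; case: ifP => _ //; left; exists Z.
case=> // dV; exists Z0 => //; apply/eqP.
by rewrite eqn_leq lb //= dV max_card.
Qed.

Definition P3 : {set {set V} * {set V} * {set V}} :=
  [set t : {set V} * {set V} * {set V} | let: (A, B, C) := t in
    [&& [disjoint A & B], [disjoint A & C], [disjoint B & C]
      & A :|: B :|: C == [set: V]]].

(* One indeterminate y, and indeterminates a_S, b_S, c_S for every subset S. *)
Definition indet : finType := (unit + ({set V} + {set V} + {set V}))%type.

Definition Qring := {mpoly int[#|indet|]}.

Definition var (i : indet) : Qring := 'X_(enum_rank i).

Definition y_ : Qring := var (inl tt).
Definition a_ (S : {set V}) : Qring := var (inr (inl (inl S))).
Definition b_ (S : {set V}) : Qring := var (inr (inl (inr S))).
Definition c_ (S : {set V}) : Qring := var (inr (inr S)).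

Definition Q M : Qring :=
  \sum_(t in P3) let: (A, B, C) := t in
    a_ A * b_ B * c_ C * y_ ^+ dist (dpivot (pivot M B) C) set0.

End SetSystems.

Arguments y_ {V}.

(* Main.v *)
Require Import Defs.
From mathcomp Require Import all_boot all_order all_algebra.

(** At each vertex [u], the operations [+u] and [*u] are involutions satisfying
the braid relation [*u+u*u = +u*u+u], and operations at distinct vertices
commute.  Hence a vertexwise computation turns [(M+Y)*B\bar{*}C] into
[M*B'\bar{*}C'+Y''] for suitable [B'], [C'], [Y''], and likewise for [M*Y] and
[M\bar{*}Y].  The final loop complementations do not change the minimum size of
a set in the family, so the identities follow by reindexing the sum along the
involution of triples [(A, B, C) -> (A, B', C')] and its two analogues. *)

Local Open Scope ring_scope.

Section SetSystemActions.
Set Implicit Arguments.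
Unset Strict Implicit.
Variable V : finType.
Implicit Types (M : set_system V) (A B C X Y Z : {set V}) (u v : V).
Implicit Types (w : seq bool) (W : V -> seq bool).

Lemma in_symdiff (T : finType) (A B : {set T}) x :
  (x \in A :+: B) = (x \in A) (+) (x \in B).
Proof. by rewrite !inE; case: (x \in A); case: (x \in B). Qed.

Lemma symdiffK X : involutive (fun Z => Z :+: X).
Proof. by move=> Z; apply/setP=> x; rewrite !in_symdiff addbK. Qed.

Lemma in_pivot M X Z : (Z \in pivot M X) = (Z :+: X \in M).
Proof.
by rewrite -{1}[Z](symdiffK X) (mem_imset _ _ (inv_inj (symdiffK X))).
Qed.

Lemma in_loopc1 M u Z :
  (Z \in loopc1 M u) = (Z \in M) (+) ((u \in Z) && (Z :\ u \in M)).
Proof.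
rewrite in_symdiff; congr (_ (+) _); apply/imsetP/andP.
  by case=> Z'; rewrite inE => /andP[MZ' uZ'] ->; rewrite setU11 setU1K.
by case=> uZ MZ; exists (Z :\ u); rewrite ?setD1K // !inE eqxx MZ.
Qed.

Lemma pivotK X : involutive (fun M => pivot M X).
Proof. by move=> M; apply/setP=> Z; rewrite !in_pivot symdiffK. Qed.

Lemma loopc1K u : involutive (fun M => loopc1 M u).
Proof.
move=> M; apply/setP=> Z; rewrite !in_loopc1 !inE eqxx /= addbF.
by rewrite addbK.
Qed.

(** For [u] outside [Z], let [p], [q] be the membership bits of [Z] and [u |: Z]. Then [+u] sends
    [(p, q)] to [(p, p + q)] mod 2 and [*u] swaps the bits, so both generate a copy of the symmetric
    group on three letters; each side here yields [(p + q, q)]. *)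
Lemma loopc1_pivot_braid M u :
  pivot (loopc1 (pivot M [set u]) u) [set u]
    = loopc1 (pivot (loopc1 M u) [set u]) u.
Proof.
have D1 Z : u \in Z -> Z :+: [set u] = Z :\ u.
  move=> uZ; apply/setP=> x; rewrite in_symdiff !inE.
  by case: (eqVneq x u) => [->|_] /=; rewrite ?uZ ?addbF.
have U1 Z : u \notin Z -> (Z :+: [set u]) :\ u = Z.
  move=> uZ; apply/setP=> x.
  rewrite in_setD1 in_symdiff in_set1.
  by case: (eqVneq x u) => [->|_] /=; rewrite ?(negPf uZ) ?addbF.
apply/setP=> Z; rewrite !(in_pivot, in_loopc1) symdiffK in_symdiff set11 addbT.
case: (boolP (u \in Z)) => uZ /=; last by rewrite U1 // addbF addbC.
have ZuK : (Z :\ u) :+: [set u] = Z by rewrite -D1 // symdiffK.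
by rewrite D1 // ZuK uZ /= !addbF addbC addbK.
Qed.

Lemma loopc1C M u v : loopc1 (loopc1 M u) v = loopc1 (loopc1 M v) u.
Proof.
case: (eqVneq u v) => [->//|uv].
apply/setP=> Z; rewrite !in_loopc1 !inE uv eq_sym uv /= setDDl setUC -setDDl.
by do 2![case: (_ \in Z)]; rewrite /= ?addbF // addbACA.
Qed.

Lemma pivotC M X Y : pivot (pivot M X) Y = pivot (pivot M Y) X.
Proof.
apply/setP=> Z; rewrite !in_pivot; congr (_ \in M).
by apply/setP=> x; rewrite !in_symdiff addbAC.
Qed.

Lemma loopc1_pivotC M u v : u != v ->
  loopc1 (pivot M [set v]) u = pivot (loopc1 M u) [set v].
Proof.
move=> uv; apply/setP=> Z; rewrite !(in_pivot, in_loopc1) in_symdiff inE.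
rewrite (negPf uv) addbF; congr (_ (+) (_ && (_ \in M))).
apply/setP=> x; rewrite !(in_symdiff, in_setD1, in_set1).
by case: (eqVneq x u) => //= ->; rewrite (negPf uv).
Qed.

(* Words encode composites of operations at one vertex: [true] stands for [+u]
   and [false] for [*u], read from left to right. *)
Definition step u M (b : bool) : set_system V :=
  if b then loopc1 M u else pivot M [set u].

Definition act w u M : set_system V := foldl (step u) M w.

Definition run W M (s : seq V) : set_system V :=
  foldl (fun N u => act (W u) u N) M s.

Lemma act_cat w1 w2 u M : act (w1 ++ w2) u M = act w2 u (act w1 u M).
Proof. exact: foldl_cat. Qed.

Lemma step_actC b w u v M : u != v ->
  step u (act w v M) b = act w v (step u M b).
Proof.
move=> uv; elim: w M => //= c w IH M; rewrite IH; congr act.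
case: b {IH}; case: c => /=.
- exact: loopc1C.
- exact: loopc1_pivotC.
- by rewrite loopc1_pivotC // eq_sym.
- exact: pivotC.
Qed.

Lemma actC w1 w2 u v M : u != v ->
  act w1 u (act w2 v M) = act w2 v (act w1 u M).
Proof. by move=> uv; elim: w1 M => //= b w1 IH M; rewrite step_actC. Qed.

Lemma act_runC w W u M s : u \notin s ->
  act w u (run W M s) = run W (act w u M) s.
Proof.
elim: s M => //= v s IH M; rewrite inE negb_or => /andP[uv us].
by rewrite IH // actC.
Qed.

(** Since [u] does not recur in [s], its second word can be moved past the first words of all later
    vertices. Identities between global operations thus reduce to identities between words at one
    vertex. *)
Lemma run_cat W1 W2 M s : uniq s ->
  run W2 (run W1 M s) s = run (fun u => W1 u ++ W2 u) M s.
Proof.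
elim: s M => //= u s IH M /andP[us s_uniq].
by rewrite act_runC // IH // act_cat.
Qed.

Lemma eq_run W1 W2 M s : (forall u N, act (W1 u) u N = act (W2 u) u N) ->
  run W1 M s = run W2 M s.
Proof. by move=> eqW; elim: s M => //= u s IH M; rewrite eqW IH. Qed.

Definition word_on w X u : seq bool := if u \in X then w else [::].

(** Giving vertices outside [X] the empty word lets operations on different sets run over the same
    list [enum V], as [run_cat] requires. *)
Lemma run_word_on w X M :
  run (word_on w X) M (enum V) = foldl (fun N u => act w u N) M (enum X).
Proof.
rewrite /run enumT [enum X]/enum_mem.
elim: (Finite.enum V) M => //= u s IH M.
by rewrite IH /word_on; case: (u \in X).
Qed.

Lemma loopcE M X : loopc M X = run (word_on [:: true] X) M (enum V).
Proof. by rewrite run_word_on. Qed.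

Lemma dpivotE M X :
  dpivot M X = run (word_on [:: true; false; true] X) M (enum V).
Proof. by rewrite run_word_on. Qed.

Lemma pivotE M X : pivot M X = run (word_on [:: false] X) M (enum V).
Proof.
rewrite run_word_on; apply/setP=> Z; rewrite in_pivot.
(* The set is read off its duplicate-free enumeration, so that induction on the list can toggle one
   element at a time. *)
have -> : Z :+: X = Z :+: [set x in enum X].
  by apply/setP=> x; rewrite !in_symdiff inE mem_enum.
elim: (enum X) (enum_uniq X) M => [_|u s IH /= /andP[us s_uniq]] M.
  by congr (_ \in M); apply/setP=> x; rewrite in_symdiff !inE addbF.
rewrite -IH // in_pivot; congr (_ \in M); apply/setP=> x.
rewrite !(in_symdiff, inE) -addbA; congr (_ (+) _).
by case: (eqVneq x u) => [->|]; rewrite ?(negPf us) ?addbF.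
Qed.

(** A smallest member [Z] of [M] either survives in [M+u], or is cancelled because [u] lies in [Z]
    and [Z :\ u] is in [M]; then [Z :\ u] survives and is no larger. *)
Lemma dist_loopc1_le M u : (dist (loopc1 M u) set0 <= dist M set0)%N.
Proof.
have s0 Z : set0 :+: Z = Z by apply/setP=> x; rewrite in_symdiff inE.
(* The empty family is fixed by [+u], so the default value of [dist] causes no discrepancy. *)
case: (boolP (proper_system M)) => [pM|]; last first.
  rewrite negbK => /eqP M0; suff -> : loopc1 M u = M by [].
  by apply/setP=> Z; rewrite in_loopc1 M0 !inE andbF.
have [[Z MZ ->] _] := distP set0 pM.
have le Z' : Z' \in loopc1 M u -> (dist (loopc1 M u) set0 <= #|Z'|)%N.
  move=> NZ'; have pN : proper_system (loopc1 M u) by apply/set0Pn; exists Z'.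
  by have [_ /(_ Z' NZ')] := distP set0 pN; rewrite s0.
rewrite s0; case: (boolP (Z \in loopc1 M u)) => [/le //|].
rewrite in_loopc1 MZ addTb negbK => /andP[_ MZu].
apply: leq_trans (subset_leq_card (subD1set Z u)); apply: le.
by rewrite in_loopc1 MZu !inE eqxx.
Qed.

Lemma dist_loopc1 M u : dist (loopc1 M u) set0 = dist M set0.
Proof.
apply/eqP; rewrite eqn_leq dist_loopc1_le /=.
by rewrite -{1}[M](loopc1K u) dist_loopc1_le.
Qed.

Lemma dist_loopc M X : dist (loopc M X) set0 = dist M set0.
Proof.
rewrite /loopc; elim: (enum X) M => //= u s IH M.
by rewrite IH dist_loopc1.
Qed.

(** This pointwise form reduces facts about triples to a finite case analysis on the membership bits
    of one vertex. *)
Lemma in_P3 A B C : reflect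
  (forall u, (u \in A) + (u \in B) + (u \in C) = 1)%N ((A, B, C) \in P3 V).
Proof.
rewrite inE; apply: (iffP and4P) => [[dAB dAC dBC /eqP/setP cV] u|part].
  move: (cV u); rewrite !inE.
  case uA: (u \in A); first by rewrite (disjointFr dAB) ?(disjointFr dAC).
  by case uB: (u \in B); [rewrite (disjointFr dBC) | case: (u \in C)].
split; last by apply/eqP/setP=> u; move: (part u); rewrite !inE;
    case: (u \in A); case: (u \in B); case: (u \in C).
all: rewrite disjoint_subset; apply/subsetP=> u; move: (part u); rewrite !inE;
  by case: (u \in A); case: (u \in B); case: (u \in C).
Qed.

(** On a triple of [P3 V], a vertex of [Y :\: A] lies in exactly one of [B] and [C], so toggling
    both moves it to the other. As [A] is kept, a second application toggles the same set back. *)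
Definition swapBC Y (t : {set V} * {set V} * {set V}) :=
  let: (A, B, C) := t in (A, B :+: (Y :\: A), C :+: (Y :\: A)).
Definition swapAC Y (t : {set V} * {set V} * {set V}) :=
  let: (A, B, C) := t in (A :+: (Y :\: B), B, C :+: (Y :\: B)).
Definition swapAB Y (t : {set V} * {set V} * {set V}) :=
  let: (A, B, C) := t in (A :+: (Y :\: C), B :+: (Y :\: C), C).

Lemma swapBCK Y : involutive (swapBC Y).
Proof. by case=> [[A B] C]; rewrite /= !symdiffK. Qed.
Lemma swapACK Y : involutive (swapAC Y).
Proof. by case=> [[A B] C]; rewrite /= !symdiffK. Qed.
Lemma swapABK Y : involutive (swapAB Y).
Proof. by case=> [[A B] C]; rewrite /= !symdiffK. Qed.

Lemma swapBC_P3 Y t : t \in P3 V -> swapBC Y t \in P3 V.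
Proof.
case: t => [[A B] C] /in_P3 P; apply/in_P3=> u; move: (P u).
rewrite !in_symdiff !in_setD.
by case: (u \in A); case: (u \in B); case: (u \in C); case: (u \in Y).
Qed.
Lemma swapAC_P3 Y t : t \in P3 V -> swapAC Y t \in P3 V.
Proof.
case: t => [[A B] C] /in_P3 P; apply/in_P3=> u; move: (P u).
rewrite !in_symdiff !in_setD.
by case: (u \in A); case: (u \in B); case: (u \in C); case: (u \in Y).
Qed.
Lemma swapAB_P3 Y t : t \in P3 V -> swapAB Y t \in P3 V.
Proof.
case: t => [[A B] C] /in_P3 P; apply/in_P3=> u; move: (P u).
rewrite !in_symdiff !in_setD.
by case: (u \in A); case: (u \in B); case: (u \in C); case: (u \in Y).
Qed.

Lemma sum_P3_involution (R : nmodType) (F : {set V} * {set V} * {set V} -> R)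
    phi :
  involutive phi -> (forall t, t \in P3 V -> phi t \in P3 V) ->
  \sum_(t in P3 V) F t = \sum_(t in P3 V) F (phi t).
Proof.
move=> phiK phi_P3; rewrite (reindex_inj (inv_inj phiK)) /=.
apply: eq_bigl => t; apply/idP/idP => [|/phi_P3 //].
by move=> /phi_P3; rewrite phiK.
Qed.

(** At a vertex of [Y] in [B] this reads [++*+ = *+], and in [C] it reads [+* = +*++]. *)
Lemma dpivot_pivot_loopc M A B C Y : (A, B, C) \in P3 V ->
  dpivot (pivot (loopc M Y) (B :+: (Y :\: A))) (C :+: (Y :\: A))
    = loopc (dpivot (pivot M B) C) Y.
Proof.
move=> /in_P3 P; rewrite !loopcE !dpivotE !pivotE !run_cat ?enum_uniq //.
apply: eq_run => u N; rewrite /word_on !in_symdiff !in_setD; move: (P u).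
by case: (u \in A); case: (u \in B); case: (u \in C); case: (u \in Y) => //= _;
  rewrite ?(loopc1K, pivotK, loopc1_pivot_braid).
Qed.

(** At a vertex of [Y] in [A] the two dual pivots cancel; in [B] the braid relation gives
    [+*+* = *+], which leaves the extra [+] on [Y :&: B]. *)
Lemma dpivot_pivot_dpivot M A B C Y : (A, B, C) \in P3 V ->
  dpivot (pivot (dpivot M Y) B) (C :+: (Y :\: B))
    = loopc (dpivot (pivot M B) C) (Y :&: B).
Proof.
move=> /in_P3 P; rewrite !loopcE !dpivotE !pivotE !run_cat ?enum_uniq //.
apply: eq_run => u N; rewrite /word_on !in_symdiff !in_setD !in_setI.
move: (P u).
by case: (u \in A); case: (u \in B); case: (u \in C); case: (u \in Y) => //= _;
  rewrite ?(loopc1K, pivotK, loopc1_pivot_braid).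
Qed.

(** At a vertex of [Y] in [A] the two pivots cancel; in [C] both sides reduce to [+*], the left one
    by the braid relation. *)
Lemma dpivot_pivot_pivot M A B C Y : (A, B, C) \in P3 V ->
  dpivot (pivot (pivot M Y) (B :+: (Y :\: C))) C
    = loopc (dpivot (pivot M B) C) (Y :&: C).
Proof.
move=> /in_P3 P; rewrite !loopcE !dpivotE !pivotE !run_cat ?enum_uniq //.
apply: eq_run => u N; rewrite /word_on !in_symdiff !in_setD !in_setI.
move: (P u).
by case: (u \in A); case: (u \in B); case: (u \in C); case: (u \in Y) => //= _;
  rewrite ?(loopc1K, pivotK, loopc1_pivot_braid).
Qed.

End SetSystemActions.

Theorem theorem7 (V : finType) (M : set_system V) (hM : proper_system M)
    (Y : {set V}) :
  [/\ Q (loopc M Y) =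
        \sum_(t in P3 V) (let: (A, B, C) := t in let Y' := Y :\: A in
          a_ A * b_ (B :+: Y') * c_ (C :+: Y')
            * y_ ^+ dist (dpivot (pivot M B) C) set0),
      Q (dpivot M Y) =
        \sum_(t in P3 V) (let: (A, B, C) := t in let Y' := Y :\: B in
          a_ (A :+: Y') * b_ B * c_ (C :+: Y')
            * y_ ^+ dist (dpivot (pivot M B) C) set0)
    & Q (pivot M Y) =
        \sum_(t in P3 V) (let: (A, B, C) := t in let Y' := Y :\: C in
          a_ (A :+: Y') * b_ (B :+: Y') * c_ C
            * y_ ^+ dist (dpivot (pivot M B) C) set0)].
Proof.
split; rewrite /Q.
(* Only the left-hand sum is reindexed: its indeterminates then match the right-hand side, and it
   remains to compare the exponents of [y_]. *)
- rewrite (sum_P3_involution _ (swapBCK Y) (@swapBC_P3 _ Y)).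
  apply: eq_bigr => -[[A B] C] tP.
  by rewrite /= (dpivot_pivot_loopc _ _ tP) dist_loopc.
- rewrite (sum_P3_involution _ (swapACK Y) (@swapAC_P3 _ Y)).
  apply: eq_bigr => -[[A B] C] tP.
  by rewrite /= (dpivot_pivot_dpivot _ _ tP) dist_loopc.
- rewrite (sum_P3_involution _ (swapABK Y) (@swapAB_P3 _ Y)).
  apply: eq_bigr => -[[A B] C] tP.
  by rewrite /= (dpivot_pivot_pivot _ _ tP) dist_loopc.
Qed.
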